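(* Let $G(p)$ be a countable cable-strut tensegrity in $\mathbb{R}^d$ with uniform structure, let $\mathcal{X}$ be one of the Banach sequence spaces $c_0$ or $\ell^q$, for $1\leq q<\infty$, and suppose that the associated bar-joint framework $\overline{G(p)}$ is first-order $\mathcal{X}$-rigid and that there exists a proper $(\mathcal{X}',\mathcal{X})$-asymptotic equilibrium stress for $G(p)$. Then $G(p)$ is first-order $\mathcal{X}$-rigid.
   Context: **Tensegrities.** A countable cable-strut tensegrity $G(p)$ in $\mathbb{R}^d$ consists of a countably infinite simple graph $G=(V,E)$ with $V=\{1,2,\dots\}$, a placement $p=(p_1,p_2,\dots)$ with $p_i\in\mathbb{R}^d$, and sets $E_c$ (cables) and $E_s$ (struts), not necessarily disjoint, with $E=E_c\cup E_s$. A *member* is an element of the disjoint union $E_c\sqcup E_s$ (an edge in both sets gives two members, one cable and one strut). The associated bar-joint framework, obtained by replacing all members by bars, is $\overline{G(p)}=(G,p)$. **Flexes.** A velocity field $u=(u_1,u_2,\dots)$, $u_k\in\mathbb{R}^d$, is an infinitesimal flex of $G(p)$ if $(p_i-p_j)\cdot(u_i-u_j)\leq 0$ for $ij\in E_c$ and $(p_i-p_j)\cdot(u_i-u_j)\geq 0$ for $ij\in E_s$. It is an infinitesimal flex of $\overline{G(p)}$ if $(p_i-p_j)\cdot(u_i-u_j)=0$ for all $ij\in E$. A flex is trivial if it is a rigid motion flex, i.e. $u_i=Ap_i+b$ for all $i$, for some skew-symmetric $d\times d$ matrix $A$ and $b\in\mathbb{R}^d$. **Uniform structure.** There is an upper bound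 for the degrees of the vertices of $G$ and an upper bound for the lengths $|p_i-p_j|$ of the members. **Rigidity matrix.** $R(G(p))$ has rows indexed by members and columns indexed by vertices (a block of $d$ scalar columns per vertex). The row for a member $e$ on the edge $ij$ has entry $\mathrm{sgn}(e)(p_i-p_j)$ in the block for $i$, $\mathrm{sgn}(e)(p_j-p_i)$ in the block for $j$, and zeros elsewhere, where $\mathrm{sgn}(e)=-1$ if $e$ is a cable and $+1$ if $e$ is a strut. **Spaces.** $\mathcal{X}\otimes\mathbb{R}^d$ is the Banach space of sequences $u=(u_k)$ in $\mathbb{R}^d$ whose coordinate sequences lie in $\mathcal{X}$, with the natural norm (all choices of norm on $\mathbb{R}^d$ give equivalent norms); similarly for $\mathcal{X}'\otimes\mathbb{R}^d$, where $\mathcal{X}'$ is the dual sequence space: $c_0'=\ell^1$, $(\ell^1)'=\ell^\infty$, and $(\ell^q)'=\ell^{q'}$ with $1/q+1/q'=1$ for $1<q<\infty$. **First-order $\mathcal{X}$-rigidity.** $G(p)$ (resp. $\overline{G(p)}$) is first-order $\mathcal{X}$-rigid if every infinitesimal flex of $G(p)$ (resp. $\overline{G(p)}$) belonging to $\mathcal{X}\otimes\mathbb{R}^d$ is trivial. **Proper $(\mathcal{X}',\mathcal{X})$-asymptotic equilibrium stress.** A stress field is a real-valued function $\omega=(\omega_e)$ on the members, and $|\omega|=(|\omega_e|)$, viewed as a row vector. A proper $(\mathcal{X}',\mathcal{X})$-asymptotic equilibrium stress for $G(p)$ is a sequence $\omega^{(n)}$, $n=1,2,\dots$, of finitely nonzero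 stress fields such that (i) $\omega^{(n)}_e\leq 0$ if $e$ is a cable and $\omega^{(n)}_e\geq 0$ if $e$ is a strut; (ii) for every member $e$ there is $\delta_e>0$ such that $|\omega^{(n)}_e|\geq\delta_e$ for all sufficiently large $n$; and (iii) $|\omega^{(n)}|R(G(p))\to 0$ as $n\to\infty$ in the weak-star topology of $\mathcal{X}'\otimes\mathbb{R}^d$ given by the pairing with $\mathcal{X}\otimes\mathbb{R}^d$, i.e. $|\omega^{(n)}|R(G(p))u\to 0$ for every $u\in\mathcal{X}\otimes\mathbb{R}^d$. *)

(* Defs.v *)
From HB Require Import structures.
From mathcomp Require Import all_boot all_order all_algebra.
From mathcomp Require Import all_classical all_reals all_analysis.
From mathcomp Require Import ess_sup_inf.

Set Implicit Arguments.
Unset Strict Implicit.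
Unset Printing Implicit Defensive.

Import Order.TTheory GRing.Theory Num.Theory.
Import numFieldNormedType.Exports.

Local Open Scope classical_set_scope.
Local Open Scope ring_scope.

Definition dot (R : realType) (d : nat) (x y : 'cV[R]_d) : R :=
  \sum_i x i 0 * y i 0.

Definition euclidean_norm (R : realType) (d : nat) (x : 'cV[R]_d) : R :=
  Num.sqrt (dot x x).

(* The vertex set is nat. The edge between i and j is encoded by the ordered
   pair (minn i j, maxn i j); every notion below is invariant under swapping
   the two ends of an edge. *)
Record tensegrity (R : realType) (d : nat) := Tensegrity {
  placement : nat -> 'cV[R]_d ;
  cables : set (nat * nat) ;
  struts : set (nat * nat) ;
  cables_ordered : cables `<=` [set e | (e.1 < e.2)%N] ;
  struts_ordered : struts `<=` [set e | (e.1 < e.2)%N] }.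

Section Tensegrity.
Context {R : realType} {d : nat}.
Implicit Types (G : tensegrity R d) (u : nat -> 'cV[R]_d).

Definition edges G : set (nat * nat) := cables G `|` struts G.

(* The disjoint union: an edge that is both a cable and a strut gives two
   members. *)
Definition member G : choiceType := (cables G + struts G)%type.

Definition ends G (e : member G) : nat * nat :=
  match e with inl c => val c | inr s => val s end.

Definition sgn G (e : member G) : R :=
  match e with inl _ => -1 | inr _ => 1 end.

Definition strain G u (e : nat * nat) : R :=
  dot (placement G e.1 - placement G e.2) (u e.1 - u e.2).

Definition infinitesimal_flex G u : Prop :=
  (forall e, cables G e -> strain G u e <= 0) /\
  (forall e, struts G e -> 0 <= strain G u e).

Definition bar_infinitesimal_flex G u : Prop :=
  forall e, edges G e -> strain G u e = 0.

Definition trivial_flex G u : Prop :=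
  exists (A : 'M[R]_d) (b : 'cV[R]_d),
    A^T = - A /\ forall k, u k = A *m placement G k + b.

Definition neighbours G (k : nat) : set nat :=
  [set j | edges G (k, j) \/ edges G (j, k)].

Definition uniform_structure G : Prop :=
  (exists D : nat, forall k, (neighbours G k #<= `I_D)%card) /\
  (exists L : R, forall e : member G,
    euclidean_norm (placement G (ends e).1 - placement G (ends e).2) <= L).

(* The entry is the whole block of d scalar columns of vertex k, as a vector. *)
Definition rigidity_matrix G (e : member G) (k : nat) : 'cV[R]_d :=
  let: (i, j) := ends e in
  if k == i then sgn e *: (placement G i - placement G j)
  else if k == j then sgn e *: (placement G j - placement G i)
  else 0.

Definition c0 : set (nat -> R) := [set x | x @ \oo --> (0 : R)].

Definition ell (q : \bar R) : set (nat -> R) :=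
  [set x | x \in Lfun counting q].

(* hoelder_conjugate 1 = +oo, so the dual of ell 1 is the space of bounded
   sequences. *)
Inductive dual_pair : set (nat -> R) -> set (nat -> R) -> Prop :=
| dual_pair_c0 : dual_pair (ell 1%E) c0
| dual_pair_ell (q : R) : 1 <= q ->
    dual_pair (ell (hoelder_conjugate q%:E)) (ell q%:E).

Definition tensor (X : set (nat -> R)) : set (nat -> 'cV[R]_d) :=
  [set u | forall i, X (fun k => u k i 0)].

Definition pairing (v u : nat -> 'cV[R]_d) : R :=
  limn (series (fun k => dot (v k) (u k))).

Definition weak_star_cvg0 (X' X : set (nat -> R))
    (v : nat -> nat -> 'cV[R]_d) : Prop :=
  (forall n, tensor X' (v n)) /\
  (forall u, tensor X u -> pairing (v n) u @[n --> \oo] --> (0 : R)).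

Definition first_order_rigid (X : set (nat -> R)) G : Prop :=
  forall u, tensor X u -> infinitesimal_flex G u -> trivial_flex G u.

Definition bar_first_order_rigid (X : set (nat -> R)) G : Prop :=
  forall u, tensor X u -> bar_infinitesimal_flex G u -> trivial_flex G u.

Definition finitely_nonzero G (w : member G -> R) : Prop :=
  finite_set [set e | w e != 0].

(* The row vector w R(G(p)); the sum is finite when w is finitely nonzero. *)
Definition stress_row G (w : member G -> R) (k : nat) : 'cV[R]_d :=
  \sum_(e \in [set: member G]) w e *: rigidity_matrix e k.

Definition proper_asymptotic_equilibrium_stress (X' X : set (nat -> R)) G
    (w : nat -> member G -> R) : Prop :=
  [/\ forall n, finitely_nonzero (w n),
      forall n (e : member G),
        match e with inl _ => w n e <= 0 | inr _ => 0 <= w n e end,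
      forall e, exists2 delta : R, 0 < delta &
        \forall n \near \oo, delta <= `|w n e| &
      weak_star_cvg0 X' X (fun n => stress_row (fun e => `|w n e|))].

Lemma ell_finite_support (q : \bar R) (x : nat -> R) : (1 <= q)%E ->
  finite_set [set k | x k != 0] -> ell q x.
Proof.
move=> q1 /finite_seqP[s xs].
have x0 k : k \notin s -> x k = 0.
  move=> ks; apply/eqP; apply: contraNT ks => xk.
  by have : [set k | x k != 0] k by []; rewrite xs.
rewrite /ell/= inE/=; apply/andP; split; rewrite inE//= /finite_norm.
case: q q1 => [q| |]//.
- rewrite lee_fin => q1.
  have q0 : 0 < q by apply: lt_le_trans q1.
  rewrite Lnorm_counting//; apply: poweR_lty.
  pose N := (\max_(k <- s) k).+1.
  rewrite (nneseries_split 0 N); last by move=> k _; exact: poweR_ge0.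
  rewrite add0n [X in (_ + X)%E]eseries0 ?adde0; last first.
    move=> k Nk _ /=; rewrite x0 ?normr0 ?powR0 ?gt_eqF//.
    apply/negP => ks; have := @leq_bigmax_seq _ s xpredT (fun k => k) k ks isT.
    by rewrite leqNgt => /negP; apply.
  by apply/lte_sum_pinfty => k _ /=; rewrite ltry.
- move=> _; rewrite unlock; case: ifPn => [_|_]; last by rewrite ltry.
  apply: (@le_lt_trans _ _ (\sum_(k <- undup s) `|x k|)%:E); last exact: ltry.
  apply/ess_supP; apply: nearW => k /=; rewrite lee_fin.
  have [ks|/x0 ->] := boolP (k \in s); last first.
    by rewrite normr0 sumr_ge0.
  by rewrite (bigD1_seq k) ?mem_undup ?undup_uniq//= lerDl sumr_ge0.
Qed.

(* Hence the first clause of weak_star_cvg0 imposes nothing on a sequence of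
   finitely nonzero stresses. *)
Lemma stress_row_tensor (X' X : set (nat -> R)) G (w : member G -> R) :
  dual_pair X' X -> finitely_nonzero w -> tensor X' (stress_row w).
Proof.
move=> X'X w_fin.
suff rowX' (q : \bar R) : (1 <= q)%E -> tensor (ell q) (stress_row w).
  by case: X'X => [|q q1]; apply: rowX' => //; exact: hoelder_conj_ge1.
move=> q1 i; apply: ell_finite_support => //.
apply: (@sub_finite_set _ _ (((fun e => (ends e).1) @` [set e | w e != 0]) `|`
                             ((fun e => (ends e).2) @` [set e | w e != 0]))).
  move=> k /= rk; apply: contrapT => /not_orP[k1 k2].
  move/eqP: rk; apply; rewrite /stress_row fsbig1 ?mxE// => e _.
  have [->|we] := eqVneq (w e) 0; first by rewrite scale0r.
  rewrite /rigidity_matrix; case E : (ends e) => [a b].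
  have [ka|_] := eqVneq k a; first by case: k1; exists e; rewrite //= E.
  have [kb|_] := eqVneq k b; first by case: k2; exists e; rewrite //= E.
  by rewrite scaler0.
by rewrite finite_setU; split; exact: finite_image.
Qed.

End Tensegrity.

(* Main.v *)
Require Import Defs.
From mathcomp Require Import all_boot all_order all_algebra finmap.
From mathcomp Require Import all_classical all_reals all_analysis.

(** Pairing the stress row of a finitely nonzero [w] with a velocity field [u]
    gives the sum of [w e * (sgn e * strain e)] over the members. For an
    infinitesimal flex and [w = |omega^(n)|] all these terms are nonnegative, so
    each of them is squeezed between 0 and a pairing that tends to 0. As
    [|omega^(n)_e|] stays away from 0, every strain vanishes: [u] is a flex of
    the bar-joint framework. *)

Set Implicit Arguments.
Unset Strict Implicit.
Unset Printing Implicit Defensive.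

Import Order.TTheory GRing.Theory Num.Theory.
Import numFieldNormedType.Exports.

Local Open Scope classical_set_scope.
Local Open Scope ring_scope.

Section Dot.
Context {R : realType} {d : nat}.
Implicit Types x y z : 'cV[R]_d.

Lemma dotDl x y z : dot (x + y) z = dot x z + dot y z.
Proof. by rewrite /dot -big_split; apply: eq_bigr => i _; rewrite mxE mulrDl. Qed.

Lemma dotZl (a : R) x y : dot (a *: x) y = a * dot x y.
Proof. by rewrite /dot mulr_sumr; apply: eq_bigr => i _; rewrite mxE mulrA. Qed.

Lemma dot0l y : dot 0 y = 0.
Proof. by rewrite -(scale0r 0) dotZl mul0r. Qed.

Lemma dotBr x y z : dot x (y - z) = dot x y - dot x z.
Proof. by rewrite /dot -sumrB; apply: eq_bigr => i _; rewrite !mxE mulrBr. Qed.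

Lemma dot_suml (I : Type) (s : seq I) (F : I -> 'cV[R]_d) y :
  dot (\sum_(i <- s) F i) y = \sum_(i <- s) dot (F i) y.
Proof. exact: (big_morph _ (fun x z => dotDl x z y) (dot0l y)). Qed.

End Dot.

Section Stress.
Context {R : realType} {d : nat} (G : tensegrity R d).
Implicit Types (u : nat -> 'cV[R]_d) (e : member G) (w : member G -> R).

Lemma ends_ltn e : ((ends e).1 < (ends e).2)%N.
Proof.
by case: e => -[e /= /set_mem ee]; [exact: cables_ordered ee|exact: struts_ordered ee].
Qed.

(** The nested tests on [k] become a difference of two indicators, linear in each end; this is sound
    because the ends are distinct, so at most one indicator is 1. *)
Lemma rigidity_matrixE e k : rigidity_matrix e k =
  (sgn e * ((k == (ends e).1)%:R - (k == (ends e).2)%:R)) *: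
    (placement G (ends e).1 - placement G (ends e).2).
Proof.
have := ends_ltn e; rewrite /rigidity_matrix.
case: (ends e) => i j /= ij.
have [->|_] := eqVneq k i; first by rewrite (ltn_eqF ij) subr0 mulr1.
have [_|_] := eqVneq k j; last by rewrite subrr mulr0 scale0r.
by rewrite sub0r mulrN1 scaleNr -scalerN opprB.
Qed.

(** A row is supported on its two ends, so its partial sums are constant once the larger end,
    [(ends e).2], has been passed. *)
Lemma series_rigidity_matrix e u n : ((ends e).2 < n)%N ->
  series (fun k => dot (rigidity_matrix e k) (u k)) n = sgn e * strain G u (ends e).
Proof.
move=> jn; have ij := ends_ltn e.
have pick i (F : nat -> R) : (i < n)%N -> \sum_(0 <= k < n) (k == i)%:R * F k = F i.
  move=> lt_in; under eq_bigr do rewrite mulr_natl mulrb.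
  by rewrite -big_mkcond big_nat1_eq lt_in.
pose F k := dot (placement G (ends e).1 - placement G (ends e).2) (u k).
rewrite /strain dotBr /series/=.
(* Each of the two values of [F] in the strain is expanded into an indicator sum, so that both sides
   agree term by term in [k]. *)
rewrite -[X in _ * (X - _)](pick _ F (ltn_trans ij jn)) -[X in _ * (_ - X)](pick _ F jn).
rewrite -sumrB mulr_sumr; apply: eq_bigr => k _.
by rewrite rigidity_matrixE dotZl -mulrA mulrBl.
Qed.

(** The sum over members is finite and each inner series is eventually constant, so limit and sum
    commute without any summability of [u]. Any finite [s] containing the support is allowed, which
    leaves room to adjoin a chosen member. *)
Lemma pairing_stress_row w u (s : {fset member G}) :
    [set e | w e != 0] `<=` [set` s] ->
  pairing (stress_row w) u = \sum_(e <- s) w e * (sgn e * strain G u (ends e)).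
Proof.
move=> ws; apply: cvg_lim; first exact: Rhausdorff.
pose row_e e := fun k => dot (rigidity_matrix e k) (u k).
have rowE k : dot (stress_row w k) (u k) = \sum_(e <- s) w e * row_e e k.
  rewrite /stress_row (@fsbigTE _ _ _ _ s).
    by rewrite dot_suml; apply: eq_bigr => e _; rewrite dotZl.
  move=> e es; have [->|we] := eqVneq (w e) 0; first exact: scale0r.
  by case/negP: es; exact: ws.
have -> : series (fun k => dot (stress_row w k) (u k)) =
    (fun n => \sum_(e <- s) w e * series (row_e e) n).
  apply/funext => n; rewrite /series/=; under eq_bigr do rewrite rowE.
  by rewrite exchange_big; apply: eq_bigr => e _; rewrite mulr_sumr.
apply: cvg_big => [|e _]; first exact: add_continuous.
apply: cvgM; [exact: cvg_cst|apply: cvg_near_cst].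
(* The partial sum of index [n] stops at [n - 1], hence the successor. *)
by exists (ends e).2.+1 => // n /= jn; apply/eqP; rewrite series_rigidity_matrix.
Qed.

Lemma flex_sgn_strain_ge0 u e : infinitesimal_flex G u ->
  0 <= sgn e * strain G u (ends e).
Proof.
move=> [uc us]; case: e => -[e /= /set_mem ee].
  by rewrite mulN1r oppr_ge0 uc.
by rewrite mul1r us.
Qed.

Lemma le_pairing_stress_row w u e : finitely_nonzero w -> (forall e', 0 <= w e') ->
  infinitesimal_flex G u ->
  w e * (sgn e * strain G u (ends e)) <= pairing (stress_row w) u.
Proof.
move=> w_fin w_ge0 u_flex.
have ge0 e' : 0 <= w e' * (sgn e' * strain G u (ends e')).
  by rewrite mulr_ge0// flex_sgn_strain_ge0.
have [s /seteqP[ws _]] := finite_fsetP.1 w_fin.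
(* [e] may lie outside the support of [w]; adjoining it makes its term one of the nonnegative
   summands. *)
rewrite (@pairing_stress_row _ _ (e |` s)%fset).
  by rewrite (big_fsetD1 e) ?fset1U1//= lerDl sumr_ge0.
by move=> e' /ws /= se'; rewrite in_fset1U se' orbT.
Qed.

Lemma flex_sgn_strain_eq0 (X' X : set (nat -> R)) (w : nat -> member G -> R) u e :
    proper_asymptotic_equilibrium_stress X' X w ->
  tensor X u -> infinitesimal_flex G u -> sgn e * strain G u (ends e) = 0.
Proof.
move=> [w_fin _ w_far [_ w_cvg]] uX u_flex.
have [delta delta_gt0 w_ge] := w_far e.
set t := sgn e * _; have t_ge0 : 0 <= t := flex_sgn_strain_ge0 e u_flex.
suff : delta * t <= 0.
  by rewrite pmulr_rle0// => t_le0; apply/eqP; rewrite eq_le t_le0.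
(* With 0 written as the limit of the pairings, it suffices to bound them below by [delta * t] for
   large [n]. *)
rewrite -(cvg_lim (@Rhausdorff R) (w_cvg u uX)).
apply: limr_ge; first by apply/cvg_ex; exists 0; exact: w_cvg.
apply: filterS w_ge => n w_ge; apply: (@le_trans _ _ (`|w n e| * t)).
  exact: ler_wpM2r.
apply: (@le_pairing_stress_row (fun e' => `|w n e'|)) => //.
by rewrite /finitely_nonzero; under eq_set do rewrite normr_eq0; exact: w_fin.
Qed.

End Stress.

Theorem lemma2p6 (R : realType) (d : nat) (G : tensegrity R d)
    (X' X : set (nat -> R)) (X'X : dual_pair X' X)
    (G_uniform : uniform_structure G)
    (bar_rigid : bar_first_order_rigid X G)
    (G_stress : exists w : nat -> member G -> R,
      proper_asymptotic_equilibrium_stress X' X w) :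
  first_order_rigid X G.
Proof.
move=> u uX u_flex; apply: bar_rigid => // e.
have [w w_stress] := G_stress.
have strain0 e' := flex_sgn_strain_eq0 e' w_stress uX u_flex.
(* Every edge carries a cable or a strut; either member gives zero strain, its sign being
   invertible. *)
move=> [ce|se].
  have /= := strain0 (inl (exist _ e (mem_set ce))).
  by rewrite mulN1r => /eqP; rewrite oppr_eq0 => /eqP.
have /= := strain0 (inr (exist _ e (mem_set se))).
by rewrite mul1r.
Qed.
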